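(* Let $\lambda\in\mathbb{K}$. For each $n\ge1$ let $\mathcal{Q}^\lambda_n:=\mathbb{K}[x_1,\dots,x_n]$ with identity $1\in\mathbb{K}[x_1]$ and partial compositions $$(P\circ_iQ)(x_1,\dots,x_{n+m-1}):=P(x_1,\dots,x_{i-1},\theta^\lambda(x_i,\dots,x_{i+m-1}),x_{i+m},\dots,x_{n+m-1})\,Q(x_i,\dots,x_{i+m-1}).$$ Then $\mathcal{Q}^\lambda$ is a ns operad isomorphic to $\lambda\text{-}AsDer$, via $\mathrm{id}\mapsto 1\in\mathbb{K}[x_1]$, $D\mapsto x_1$, $\mu\mapsto 1\in\mathbb{K}[x_1,x_2]$; equivalently $\gamma(P;Q_1,\dots,Q_k)=P(\theta^\lambda(x_1,\dots,x_{i_1}),\theta^\lambda(x_{i_1+1},\dots,x_{i_1+i_2}),\dots)\,Q_1(x_1,\dots,x_{i_1})\,Q_2(x_{i_1+1},\dots,x_{i_1+i_2})\cdots$. Under this isomorphism the operation $(a_1,\dots,a_n)\mapsto D^{j_1}(a_1)\cdots D^{j_n}(a_n)$ corresponds to $x_1^{j_1}\cdots x_n^{j_n}$; in particular $\lambda\text{-}AsDer_n\cong\mathbb{K}[x_1,\dots,x_n]$.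
   Context: $\mathbb{K}$ is a commutative unital ring. A $\lambda$-derivation of an associative algebra $A$ is a linear map $D^A:A\to A$ with $D^A(ab)=D^A(a)b+aD^A(b)+\lambda D^A(a)D^A(b)$. $\lambda\text{-}AsDer$ is the ns operad governing associative algebras with a $\lambda$-derivation: generated by a unary $D$ and binary $\mu$ with relations $\mu\circ_1\mu=\mu\circ_2\mu$ and $D\circ_1\mu=\mu\circ_1D+\mu\circ_2D+\lambda(\mu\circ_1D)\circ_2D$. For variables $x_1,\dots,x_n$, $\theta^\lambda(x_1,\dots,x_n):=\sum_{k=1}^n\lambda^{k-1}\theta_k(x_1,\dots,x_n)$, where $\theta_k$ is the $k$th elementary symmetric function (so $\theta^\lambda=x_1+\cdots+x_n+\cdots+\lambda^{n-1}x_1\cdots x_n$). A ns operad is a family $(\mathcal{P}_n)_{n\ge1}$ with unit $\mathrm{id}\in\mathcal{P}_1$ and partial compositions $\circ_i:\mathcal{P}_m\otimes\mathcal{P}_n\to\mathcal{P}_{m+n-1}$ satisfying unitality, $(\lambda\circ_i\mu)\circ_{i-1+j}\nu=\lambda\circ_i(\mu\circ_j\nu)$ and $(\lambda\circ_i\mu)\circ_{k+m-1}\nu=(\lambda\circ_k\nu)\circ_i\mu$ for $i<k$. *)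

(* Defs.v *)
From HB Require Import structures.
From mathcomp Require Import all_boot all_order all_algebra.
From mathcomp Require Import mpoly.
Set Implicit Arguments. Unset Strict Implicit. Unset Printing Implicit Defensive.
Import GRing.Theory.
Local Open Scope ring_scope.

(* Conventions.  A (K-linear) ns operad is encoded by a family         *)
(*   P : nat -> lmodType K, where  P n  is the ARITY (n+1) component   *)
(* (arities are >= 1), a unit  one : P 0  (arity 1), and partial       *)
(* compositions  comp m n i : P m -> P n -> P (m+n),  i.e.             *)
(*   \circ_{i+1} : P_{m+1} (x) P_{n+1} -> P_{m+n+1}                    *)
(* with a 0-BASED slot index i (valid when i <= m; the value for       *)
(* i > m is irrelevant and never constrained).                         *)

Definition pcast (F : nat -> Type) (m n : nat) (e : m = n) (x : F m) : F n :=
  eq_rect m F x n e.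

Definition opcomp_t (K : comNzRingType) (P : nat -> lmodType K) :=
  forall m n : nat, nat -> P m -> P n -> P (m + n).

Definition is_nsOperad (K : comNzRingType) (P : nat -> lmodType K)
  (one : P 0) (comp : opcomp_t P) : Prop :=
  (forall m n i (a : K) (x y : P m) (z : P n), (i <= m)%N ->
     comp m n i (a *: x + y) z = a *: comp m n i x z + comp m n i y z) /\
  (forall m n i (a : K) (x : P m) (y z : P n), (i <= m)%N ->
     comp m n i x (a *: y + z) = a *: comp m n i x y + comp m n i x z) /\
  (forall n (p : P n), comp 0 n 0 one p = p) /\
  (forall m i (p : P m), (i <= m)%N ->
     @pcast (fun k => P k : Type) _ _ (addn0 m) (comp m 0 i p one) = p) /\
  (forall l m n i j (a : P l) (b : P m) (c : P n), (i <= l)%N -> (j <= m)%N ->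
     @pcast (fun k => P k : Type) _ _ (addnA l m n) (comp l (m + n) i a (comp m n j b c))
     = comp (l + m) n (i + j) (comp l m i a b) c) /\
  (forall l m n i k (a : P l) (b : P m) (c : P n), (i < k)%N -> (k <= l)%N ->
     comp (l + m) n (k + m) (comp l m i a b) c
     = @pcast (fun k => P k : Type) _ _ (addnAC l n m) (comp (l + n) m i (comp l n k a c) b)).

Definition is_opMorphism (K : comNzRingType)
  (P : nat -> lmodType K) (oneP : P 0) (compP : opcomp_t P)
  (R : nat -> lmodType K) (oneR : R 0) (compR : opcomp_t R)
  (f : forall n, P n -> R n) : Prop :=
  (forall n (a : K) (x y : P n), f n (a *: x + y) = a *: f n x + f n y) /\
  f 0%N oneP = oneR /\
  (forall m n i (x : P m) (y : P n), (i <= m)%N ->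
     f (m + n)%N (compP m n i x y) = compR m n i (f m x) (f n y)).

Definition AsDer_rel (K : comNzRingType) (lam : K) (P : nat -> lmodType K)
  (comp : opcomp_t P) (D : P 0) (mu : P 1) : Prop :=
  comp 1%N 1%N 0%N mu mu = comp 1%N 1%N 1%N mu mu /\
  (comp 0%N 1%N 0%N D mu : P 1%N)
  = (comp 1%N 0%N 0%N mu D : P 1%N) + (comp 1%N 0%N 1%N mu D : P 1%N)
    + lam *: (comp 1%N 0%N 1%N (comp 1%N 0%N 0%N mu D) D : P 1%N).

(* This is the defining universal property of the operad presented by    *)
(* the generators D, mu and the relations above (free ns operad modulo   *)
(* the operadic ideal generated by the relations).                       *)
Definition presents_AsDer (K : comNzRingType) (lam : K) (P : nat -> lmodType K)
  (one : P 0) (comp : opcomp_t P) (D : P 0) (mu : P 1) : Prop :=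
  is_nsOperad one comp /\ AsDer_rel lam comp D mu /\
  forall (R : nat -> lmodType K) (oneR : R 0) (compR : opcomp_t R)
         (D' : R 0) (mu' : R 1),
    is_nsOperad oneR compR -> AsDer_rel lam compR D' mu' ->
    exists f : forall n, P n -> R n,
      is_opMorphism one comp oneR compR f /\ f 0%N D = D' /\ f 1%N mu = mu' /\
      forall g : forall n, P n -> R n,
        is_opMorphism one comp oneR compR g -> g 0%N D = D' -> g 1%N mu = mu' ->
        forall n x, g n x = f n x.

Fixpoint Dpow (K : comNzRingType) (P : nat -> lmodType K) (one : P 0)
  (comp : opcomp_t P) (D : P 0) (j : nat) : P 0 :=
  match j with
  | 0%N => one
  | j'.+1 => comp 0%N 0%N 0%N D (Dpow one comp D j')
  end.

(* the operation (a_1,...,a_{r+1}) |-> D^{j}(a_1) D^{j_1}(a_2) ... D^{j_r}(a_{r+1}) *)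
(* for  js = [:: j_1; ...; j_r],  built as mu(D^j(-), rest)                 *)
Fixpoint DmonoOp (K : comNzRingType) (P : nat -> lmodType K) (one : P 0)
  (comp : opcomp_t P) (D : P 0) (mu : P 1) (j : nat) (js : seq nat)
  : P (size js) :=
  match js return P (size js) with
  | [::] => Dpow one comp D j
  | j' :: js' =>
      comp 1%N (size js') 1%N (comp 1%N 0%N 0%N mu (Dpow one comp D j))
           (DmonoOp one comp D mu j' js')
  end.

Definition esymf (R : comNzRingType) (r k : nat) (y : 'I_r -> R) : R :=
  \sum_(S : {set 'I_r} | #|S| == k) \prod_(s in S) y s.

Definition thetaL (R : comNzRingType) (lam : R) (r : nat) (y : 'I_r -> R) : R :=
  \sum_(1 <= k < r.+1) lam ^+ k.-1 * esymf k y.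

Definition Qcar (K : comNzRingType) : nat -> lmodType K :=
  fun n => {mpoly K[n.+1]}.

Definition Qone (K : comNzRingType) : Qcar K 0 := 1.

Definition Qcomp (K : comNzRingType) (lam : K) : opcomp_t (Qcar K) :=
  fun m n i (p : {mpoly K[m.+1]}) (q : {mpoly K[n.+1]}) =>
    let shift := fun j : 'I_n.+1 => ('X_(inord (i + j)) : {mpoly K[(m + n).+1]}) in
    let subst := fun k : 'I_m.+1 =>
      if (k < i)%N then ('X_(inord k) : {mpoly K[(m + n).+1]})
      else if (k == i :> nat) then thetaL (lam%:MP) shift
      else 'X_(inord (k + n)) in
    (p \mPo [tuple subst k | k < m.+1]) * (q \mPo [tuple shift j | j < n.+1]).

Definition QD (K : comNzRingType) : Qcar K 0 := 'X_0.
Definition Qmu (K : comNzRingType) : Qcar K 1 := 1.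

Definition Qmono (K : comNzRingType) (j : nat) (js : seq nat) : Qcar K (size js) :=
  \prod_(k < (size js).+1) ('X_k : {mpoly K[(size js).+1]}) ^+ nth 0%N (j :: js) k.

(* Main.v *)
(* The law [x + y + lam * x * y] is commutative and associative with unit 0,  *)
(* and theta^lam is its iteration; the operad axioms of Q follow by comparing  *)
(* substitutions.  In any operad R with a lambda-derivation, the commuting     *)
(* operators [x |-> x \circ_i D] make R n a module over the polynomial ring,   *)
(* and a morphism Q -> R is forced to be [p |-> p . mu^n], with [mu^n] the     *)
(* iterated product.  That this map respects [- \circ_i mu] is checked by      *)
(* multiplying polynomials by one variable at a time, the relation between D   *)
(* and mu handling the variable of slot i; since Q is generated by D and mu    *)
(* and the elements that may be composed on the right are closed under         *)
(* composition and linear combinations, it respects all compositions.          *)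

(* On the side of [Q], [thetaL_fgl] turns theta into an iterated associative law, and [ev_Qcomp]
   with [ev_inj] reduces each operad axiom to comparing two substituted sequences. On the side of a
   target [R], [Qcar K n] is the free module of rank one over its polynomial ring, so the
   [equivariant] maps ([1] to [muPow], variables to [act]) exist and are unique. The substance is
   that such a map is an operad morphism: [fel_mu] treats composition with [mu], and
   [right_good_all] extends this to all right factors. *)
Require Import Defs.
From HB Require Import structures.
From mathcomp Require Import all_boot all_order all_algebra.
From mathcomp Require Import mpoly ssrcomplements.
From mathcomp Require Import zify ring.
Set Implicit Arguments. Unset Strict Implicit. Unset Printing Implicit Defensive.
Import GRing.Theory.
Local Open Scope ring_scope.

(* The case of two variables of [thetaL], an associative and commutative law:  *)
(* [1 + lam * fgl lam x y = (1 + lam * x) * (1 + lam * y)].                  *)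
Definition fgl (R : comNzRingType) (lam x y : R) : R := x + y + lam * x * y.

Lemma fglA (R : comNzRingType) (lam : R) : associative (fgl lam).
Proof. by move=> x y z; rewrite /fgl; ring. Qed.

Lemma fglC (R : comNzRingType) (lam : R) : commutative (fgl lam).
Proof. by move=> x y; rewrite /fgl; ring. Qed.

Lemma fgl0x (R : comNzRingType) (lam : R) : left_id 0 (fgl lam).
Proof. by move=> x; rewrite /fgl; ring. Qed.

HB.instance Definition _ (R : comNzRingType) (lam : R) :=
  Monoid.isComLaw.Build R 0 (fgl lam) (@fglA R lam) (@fglC R lam) (@fgl0x R lam).

Lemma rmorph_bigfgl (R S : comNzRingType) (f : {rmorphism R -> S}) (lam : R)
    (I : Type) (r : seq I) (P : pred I) (y : I -> R) :
  f (\big[fgl lam/0]_(i <- r | P i) y i)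
  = \big[fgl (f lam)/0]_(i <- r | P i) f (y i).
Proof.
by apply: big_morph => [a b|]; rewrite ?rmorph0 // /fgl !rmorphD !rmorphM.
Qed.

Lemma rmorph_thetaL (R S : comNzRingType) (f : {rmorphism R -> S}) (lam : R)
    (r : nat) (y : 'I_r -> R) :
  f (thetaL lam y) = thetaL (f lam) (f \o y).
Proof.
rewrite rmorph_sum; apply: eq_bigr => k _.
rewrite rmorphM rmorphXn rmorph_sum; congr (_ * _).
by apply: eq_bigr => A _; rewrite rmorph_prod.
Qed.

Lemma mul_fgl (R : comNzRingType) (lam : R) (I : Type) (s : seq I) (y : I -> R) :
  1 + lam * \big[fgl lam/0]_(i <- s) y i = \prod_(i <- s) (1 + lam * y i).
Proof.
elim: s => [|i s IHs]; first by rewrite !big_nil mulr0 addr0.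
by rewrite !big_cons -IHs /fgl; ring.
Qed.

(** Expanding the product gives one term per subset. Grouped by cardinality, the empty set yields
    [1] and the sets of size [k] yield [lam ^+ k] times the [k]-th elementary symmetric function. *)
Lemma mul_thetaL (R : comNzRingType) (lam : R) (r : nat) (y : 'I_r -> R) :
  1 + lam * thetaL lam y = \prod_(i < r) (1 + lam * y i).
Proof.
under eq_bigr do rewrite addrC.
rewrite bigA_distr (partition_big (fun A : {set 'I_r} => inord #|A| : 'I_r.+1) predT) //=.
rewrite big_ord_recl; congr (_ + _).
  rewrite (big_pred1 set0) => [|A].
    by rewrite big1 // => i _; rewrite inE.
  rewrite /= -cards_eq0 -val_eqE /= inordK // ltnS -[r in (_ <= r)%N]card_ord.
  exact: max_card.
rewrite big_distrr /= big_add1 big_mkord; apply: eq_bigr => k _.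
rewrite mulrA -exprS big_distrr /=.
apply: eq_big => [A|A /eqP cardA].
  rewrite -val_eqE /= inordK // ltnS -[r in (_ <= r)%N]card_ord.
  exact: max_card.
rewrite -big_mkcond /= big_split /=; congr (_ * _).
by rewrite prodr_const cardA.
Qed.

(* [lam] may be a zero divisor, so the identity is proved for the          *)
(* indeterminate ['X] of [{poly R}], which can be cancelled, and           *)
(* then specialised.                                                       *)
Lemma thetaL_fgl (R : comNzRingType) (lam : R) (r : nat) (y : 'I_r -> R) :
  thetaL lam y = \big[fgl lam/0]_(i < r) y i.
Proof.
have thetaX : thetaL 'X (polyC \o y) = \big[fgl 'X/0]_(i < r) (y i)%:P.
  apply/polyP=> j.
  have : 1 + 'X * thetaL 'X (polyC \o y)
       = 1 + 'X * \big[fgl 'X/0]_(i < r) (y i)%:P.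
    by rewrite mul_thetaL mul_fgl.
  (* Coefficient [j.+1] of a multiple of ['X] is coefficient [j] of the cofactor: this cancels
     ['X]. *)
  by move/addrI/(congr1 (fun p : {poly R} => p`_j.+1)); rewrite !coefXM.
have /(congr1 (horner_eval lam)) := thetaX.
rewrite rmorph_thetaL rmorph_bigfgl /= horner_evalE hornerX => eq_th.
transitivity (thetaL lam ((horner_eval lam) \o (polyC \o y))).
  rewrite /thetaL; apply: eq_bigr => k _; congr (_ * _).
  by apply: eq_bigr => A _; apply: eq_bigr => i _; rewrite /= horner_evalE hornerC.
by rewrite eq_th; apply: eq_bigr => i _; rewrite horner_evalE hornerC.
Qed.

(** * Evaluation of polynomials along sequences *)

Section Evaluation.
Variables (K : comNzRingType) (N : nat).
Implicit Types y z : nat -> {mpoly K[N]}.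

(* Reading the variables off one sequence indexed by [nat], whatever the     *)
(* arity, makes the transports between equal arities invisible.            *)
(* arity, makes the transports between equal arities invisible.            *)
Definition ev y n (p : {mpoly K[n]}) : {mpoly K[N]} :=
  mmap (@mpolyC N K) (fun i : 'I_n => y i) p.

Lemma evE y n (p : {mpoly K[n]}) :
  ev y p = mmap (@mpolyC N K) (fun i : 'I_n => y i) p.
Proof. by []. Qed.

Lemma evD y n (p q : {mpoly K[n]}) : ev y (p + q) = ev y p + ev y q.
Proof. exact: rmorphD. Qed.

Lemma evZ y n (a : K) (p : {mpoly K[n]}) : ev y (a *: p) = a *: ev y p.
Proof. by rewrite evE mmapZ mul_mpolyC. Qed.

Lemma evM y n (p q : {mpoly K[n]}) : ev y (p * q) = ev y p * ev y q.
Proof. exact: rmorphM. Qed.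

Lemma ev1 y n : ev y (1 : {mpoly K[n]}) = 1.
Proof. exact: rmorph1. Qed.

Lemma evXn y n (p : {mpoly K[n]}) k : ev y (p ^+ k) = ev y p ^+ k.
Proof. exact: rmorphXn. Qed.

Lemma evX y n (i : 'I_n) : ev y 'X_i = y i.
Proof. by rewrite evE mmapX mmap1U. Qed.

Lemma evX_inord y n k : (k <= n)%N -> ev y ('X_(inord k) : {mpoly K[n.+1]}) = y k.
Proof. by move=> le_kn; rewrite evX inordK. Qed.

Lemma eq_ev y z n (p : {mpoly K[n]}) :
  (forall k, (k < n)%N -> y k = z k) -> ev y p = ev z p.
Proof.
move=> eq_yz; rewrite /ev /mmap; apply: eq_bigr => m _; congr (_ * _).
by apply: mmap1_eq => i; apply: eq_yz.
Qed.

Lemma ev_pcast y m n (e : m = n) (p : Qcar K m) :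
  ev y (pcast (F := fun k => Qcar K k : Type) e p : {mpoly K[n.+1]})
  = ev y (p : {mpoly K[m.+1]}).
Proof. by case: n / e. Qed.

Lemma ev_comp_mpoly y k n (p : {mpoly K[n]}) (v : 'I_n -> {mpoly K[k]})
    (z : nat -> {mpoly K[N]}) :
  (forall i : 'I_n, ev y (v i) = z i) ->
  ev y (p \mPo [tuple v i | i < n]) = ev z p.
Proof.
move=> eq_vz; rewrite comp_mpolyEX [in LHS]/ev raddf_sum /=.
rewrite /ev [RHS]/mmap; apply: eq_bigr => m _.
rewrite mmapZ comp_mpolyX rmorph_prod; congr (_ * _).
apply: eq_bigr => i _; rewrite rmorphXn tnth_map tnth_ord_tuple -eq_vz.
by [].
Qed.

(* The sequence substituted in [P] by [P \circ_{i+1} Q], for [Q] of arity [n+1]. *)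
Definition graft (lam : K) (i n : nat) y (k : nat) : {mpoly K[N]} :=
  if (k < i)%N then y k
  else if k == i then \big[fgl lam%:MP/0]_(i <= l < i + n.+1) y l
  else y (k + n)%N.

Lemma ev_Qcomp (lam : K) y m n i (p : Qcar K m) (q : Qcar K n) : (i <= m)%N ->
  ev y (Qcomp lam i p q : {mpoly K[(m + n).+1]})
  = ev (graft lam i n y) (p : {mpoly K[m.+1]})
    * ev (fun j => y (i + j)%N) (q : {mpoly K[n.+1]}).
Proof.
move=> le_im; rewrite evM; congr (_ * _); apply: ev_comp_mpoly => k; last first.
  by apply: evX_inord; have := ltn_ord k; lia.
have lt_km := ltn_ord k.
rewrite /graft; case: ltnP => [lt_ki|le_ik]; first by apply: evX_inord; lia.
case: eqVneq => [eq_ki|ne_ki]; last by apply: evX_inord; lia.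
rewrite [LHS]/ev rmorph_thetaL thetaL_fgl /= mmapC.
rewrite -[X in \big[_/_]_(X <= _ < _) _]add0n big_addn addKn big_mkord.
apply: eq_bigr => l _ /=; rewrite -evE evX_inord 1?addnC //.
by have := ltn_ord l; lia.
Qed.

End Evaluation.

Lemma graft_shift (K : comNzRingType) N (lam : K) (y : nat -> {mpoly K[N]}) i j n k :
  graft lam (i + j) n y (i + k) = graft lam j n (fun t => y (i + t)%N) k.
Proof.
rewrite /graft ltn_add2l eqn_add2l -!addnA.
case: (k < j)%N => //; case: (k == j) => //.
rewrite [(i + j)%N]addnC big_addn addKn.
by apply: eq_bigr => t _; rewrite addnC.
Qed.

(** Evaluating at the sequence of the variables themselves gives back the polynomial. *)
Lemma ev_inj (K : comNzRingType) n (p q : {mpoly K[n.+1]}) :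
  (forall N (y : nat -> {mpoly K[N]}), ev y p = ev y q) -> p = q.
Proof.
move=> eq_pq; rewrite -[p]comp_mpoly_id -[q]comp_mpoly_id.
have := eq_pq n.+1 (fun k => 'X_(inord k)); rewrite /ev /comp_mpoly.
congr (_ = _); apply: eq_bigr => m _; congr (_ * _); apply: mmap1_eq => i;
  by rewrite tnth_map tnth_ord_tuple inord_val.
Qed.

(* Unfolding them makes unification explode. *)
#[local] Opaque Qcomp ev.

(** * The operad [Q] and its lambda-derivation *)

Lemma Q_nsOperad (K : comNzRingType) (lam : K) : is_nsOperad (Qone K) (Qcomp lam).
Proof.
split; [|split; [|split; [|split; [|split]]]].
- move=> m n i a x y z le_im; apply: ev_inj => N v.
  rewrite [RHS]evD [X in _ = X + _]evZ !(ev_Qcomp _ _ _ _ le_im).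
  by rewrite evD evZ mulrDl scalerAl.
- move=> m n i a x y z le_im; apply: ev_inj => N v.
  rewrite [RHS]evD [X in _ = X + _]evZ !(ev_Qcomp _ _ _ _ le_im).
  by rewrite evD evZ mulrDr scalerAr.
- move=> n p; apply: ev_inj => N v.
  by rewrite ev_Qcomp // /Qone ev1 mul1r.
- move=> m i p le_im; apply: ev_inj => N v.
  rewrite ev_pcast ev_Qcomp // /Qone ev1 mulr1; apply: eq_ev => k lt_km.
  rewrite /graft addn0 addn1 big_nat1.
  by case: ltnP => // le_ik; case: eqVneq => [->|].
- move=> l m n i j a b c le_il le_jm; apply: ev_inj => N v.
  rewrite ev_pcast [LHS]ev_Qcomp // [X in _ * X]ev_Qcomp //.
  rewrite [RHS]ev_Qcomp ?leq_add // [X in _ = X * _]ev_Qcomp //.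
  rewrite mulrA; apply: (congr2 *%R); first apply: (congr2 *%R).
  + apply: eq_ev => k lt_kl; rewrite {1 2}/graft.
    case: (ltngtP k i) => [lt_ki|lt_ik|eq_ki].
    * by rewrite /graft ifT //; lia.
    * by rewrite /graft ifF ?ifF ?addnA //; lia.
    (* Slot [i] receives the law iterated over the whole block. Cut the block before and after the
       variables of [c]: the middle piece is the value that the inner graft puts at [i + j]. *)
    * rewrite [RHS](@big_cat_nat _ _ _ (i + j)) /=; try lia.
      rewrite [LHS](@big_cat_nat _ _ _ (i + j)) /=; try lia.
      congr (fgl _ _ _).
        by apply: eq_big_nat => t /andP[_ lt_t]; rewrite /graft lt_t.
      rewrite [RHS]big_ltn; last by lia.
      rewrite [LHS](@big_cat_nat _ _ _ (i + j + n.+1)) /=; try lia.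
      rewrite {1}/graft ltnn eqxx; congr (fgl _ _ _).
      rewrite -[(i + j + n.+1)%N]addSnnS.
      rewrite -[(i + (m + n).+1)%N in LHS](_ : (i + m.+1 + n)%N = _); last by lia.
      rewrite [LHS]big_addn addnK; apply: eq_big_nat.
      by move=> t /andP[lt_t _]; rewrite /graft ifF ?ifF //; lia.
  + by apply: eq_ev => k lt_km; rewrite graft_shift.
  + by apply: eq_ev => k lt_kn; rewrite addnA.
- move=> l m n i k a b c lt_ik le_kl; apply: ev_inj => N v.
  rewrite ev_pcast [LHS]ev_Qcomp ?leq_add2r // [X in X * _]ev_Qcomp; last by lia.
  rewrite [RHS]ev_Qcomp; last by lia.
  rewrite [X in _ = X * _]ev_Qcomp //.
  rewrite -!mulrA; apply: (congr2 *%R).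
    apply: eq_ev => t lt_tl; rewrite {1 3}/graft.
    case: (ltngtP t i) => [lt_ti|lt_it|eq_ti].
    + by rewrite /graft !ifT //; lia.
    + case: (ltngtP t k) => [lt_tk|lt_kt|->].
      * by rewrite /graft ifT ?ifF ?ifF //; lia.
      * rewrite /graft !ifF; try lia.
        by rewrite addnAC.
      * rewrite /graft ltnn eqxx -[(k + m + n.+1)%N]addnAC big_addn addnK.
        by apply: eq_big_nat => j /andP[le_kj _]; rewrite !ifF //; lia.
    + rewrite ifT ?eq_ti // [RHS]/graft ltnn eqxx.
      by apply: eq_big_nat => j /andP[_ lt_j]; rewrite /graft ifT //; lia.
  rewrite [RHS]mulrC; apply: (congr2 *%R).
    by apply: eq_ev => t lt_tm; rewrite /graft ifT //; lia.
  by apply: eq_ev => t lt_tn; rewrite /graft !ifF ?[(k + m + t)%N]addnAC //; lia.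
Qed.

(** Composing [QD] with [Qmu] substitutes theta of two variables for the variable, and the three
    terms of [fgl] are those of the derivation relation. *)
Lemma Q_AsDer (K : comNzRingType) (lam : K) : AsDer_rel lam (Qcomp lam) (QD K) (Qmu K).
Proof.
have ev_muD j N (y : nat -> {mpoly K[N]}) (le_j1 : (j <= 1)%N) :
    ev y (Qcomp lam j (Qmu K) (QD K) : {mpoly K[2]}) = y j.
  by rewrite (@ev_Qcomp _ _ _ _ 1 0 _ _ _ le_j1) ev1 mul1r evX addn0.
split; apply: ev_inj => N v.
  rewrite [LHS](@ev_Qcomp _ _ _ _ 1 1 0 _ _ isT).
  by rewrite [RHS](@ev_Qcomp _ _ _ _ 1 1 1 _ _ isT) !ev1.
rewrite [RHS]evD [X in _ = X + _]evD [X in _ = _ + X]evZ.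
rewrite [LHS](@ev_Qcomp _ _ _ _ 0 1 0 _ _ isT) evX ev1 mulr1.
rewrite [X in _ = _ + _ *: X](@ev_Qcomp _ _ _ _ 1 0 1 _ _ isT) evX.
rewrite !ev_muD //.
by rewrite /graft /= big_nat_recl // big_nat1 /fgl -mul_mpolyC mulrA.
Qed.

Lemma Dpow_QD (K : comNzRingType) (lam : K) j :
  Dpow (Qone K) (Qcomp lam) (QD K) j = ('X_0 : {mpoly K[1]}) ^+ j.
Proof.
elim: j => //= j ->; apply: ev_inj => N v.
rewrite (@ev_Qcomp _ _ _ _ 0 0) // exprS evM /QD !evX /graft /= big_nat1.
by [].
Qed.

Lemma ev_Qmono (K : comNzRingType) N (y : nat -> {mpoly K[N]}) j js :
  ev y (Qmono K j js : {mpoly K[(size js).+1]})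
  = \prod_(k < (size js).+1) y k ^+ nth 0%N (j :: js) k.
Proof.
rewrite /Qmono (big_morph _ (@evM K N y _) (ev1 y _)).
by apply: eq_bigr => k _; rewrite evXn evX.
Qed.

Lemma DmonoOp_Q (K : comNzRingType) (lam : K) (j : nat) (js : seq nat) :
  DmonoOp (Qone K) (Qcomp lam) (QD K) (Qmu K) j js = Qmono K j js.
Proof.
elim: js j => [|j' js IHjs] j.
  by rewrite /= Dpow_QD /Qmono big_ord1.
apply: ev_inj => N v; rewrite ev_Qmono big_ord_recl /=.
rewrite (@ev_Qcomp _ _ _ _ 1 (size js)) // IHjs ev_Qmono (@ev_Qcomp _ _ _ _ 1 0) //.
rewrite Dpow_QD ev1 mul1r.
by rewrite evXn evX.
Qed.

(** * Operads with a lambda-derivation, on packed elements *)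

Section Elements.
Variables (K : comNzRingType) (P : nat -> lmodType K) (comp : opcomp_t P).

Definition opel := {n : nat & P n : Type}.

Definition el n (x : P n) : opel := existT (fun n => P n : Type) n x.

(* On elements packed with their arity the operad axioms become plain       *)
(* equations, without transports.                                          *)
Definition oc (i : nat) (u v : opel) : opel :=
  el (comp i (projT2 u) (projT2 v)).

(** Equality on [nat] is decidable, so a transport along [n = n] is trivial. *)
Lemma el_inj n : injective (@el n).
Proof. by move=> x y e; have := projT2_eq e; rewrite (eq_axiomK (projT1_eq e)). Qed.

Lemma el_pcast m n (e : m = n) (x : P m) :
  el (pcast (F := fun k => P k : Type) e x) = el x.
Proof. by case: n / e. Qed.

Lemma pcast_linear m n (e : m = n) (a : K) (x y : P m) :
  pcast (F := fun k => P k : Type) e (a *: x + y)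
  = a *: (pcast (F := fun k => P k : Type) e x : P n)
    + (pcast (F := fun k => P k : Type) e y : P n).
Proof. by case: n / e. Qed.

(** The counterpart in any operad of multiplication by the variable of slot [i]; see [act_QD]. *)
Definition act (D : P 0) (i n : nat) (x : P n) : P n :=
  pcast (F := fun k => P k : Type) (addn0 n) (comp (n := 0) i x D).

Lemma el_act (D : P 0) i n (x : P n) : el (act D i x) = oc i (el x) (el D).
Proof. exact: el_pcast. Qed.

Fixpoint muPow (one : P 0) (mu : P 1) (n : nat) : P n :=
  match n with
  | 0 => one
  | n'.+1 => comp (m := 1) (n := n') 1 mu (muPow one mu n')
  end.

Section OperadLaws.
Variable one : P 0.
Hypothesis operadP : is_nsOperad one comp.

Lemma comp_linearl m n i (a : K) (x y : P m) (z : P n) : (i <= m)%N ->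
  comp i (a *: x + y) z = a *: comp i x z + comp i y z.
Proof. by case: operadP => + _; apply. Qed.

Lemma comp_linearr m n i (a : K) (x : P m) (y z : P n) : (i <= m)%N ->
  comp i x (a *: y + z) = a *: comp i x y + comp i x z.
Proof. by case: operadP => _ [+ _]; apply. Qed.

Lemma oc1l u : oc 0 (el one) u = u.
Proof.
by case: operadP u => _ [_ [op _]] [n x]; rewrite /oc /= op.
Qed.

Lemma oc1r i u : (i <= projT1 u)%N -> oc i u (el one) = u.
Proof.
case: operadP u => _ [_ [_ [op _]]] [n x] /= le_in.
exact: etrans (esym (el_pcast _ _)) (congr1 (@el n) (op _ _ _ le_in)).
Qed.

Lemma ocA i j u v w : (i <= projT1 u)%N -> (j <= projT1 v)%N ->
  oc i u (oc j v w) = oc (i + j) (oc i u v) w.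
Proof.
case: operadP u v w => _ [_ [_ [_ [op _]]]] [l a] [m b] [n c] /= le_il le_jm.
by rewrite /oc /= -op // el_pcast.
Qed.

Lemma ocAC i k u v w : (i < k)%N -> (k <= projT1 u)%N ->
  oc (k + projT1 v) (oc i u v) w = oc i (oc k u w) v.
Proof.
case: operadP u v w => _ [_ [_ [_ [_ op]]]] [l a] [m b] [n c] /= lt_ik le_kl.
by rewrite /oc /= op // el_pcast.
Qed.

Lemma ocAC0 i k u (x : P 0) w : (i < k)%N -> (k <= projT1 u)%N ->
  oc k (oc i u (el x)) w = oc i (oc k u w) (el x).
Proof. by move=> lt_ik le_ku; rewrite -[RHS]ocAC //= addn0. Qed.

Lemma act_linear (D : P 0) i n (a : K) (x y : P n) : (i <= n)%N ->
  act D i (a *: x + y) = a *: act D i x + act D i y.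
Proof. by move=> le_in; rewrite /act comp_linearl // pcast_linear. Qed.

Lemma act_comm (D : P 0) i k n (x : P n) : (i <= n)%N -> (k <= n)%N ->
  act D i (act D k x) = act D k (act D i x).
Proof.
wlog lt_ik : i k / (i < k)%N => [wlog_ik|] le_in le_kn.
  by case: (ltngtP i k) => [/wlog_ik->|/wlog_ik->|->].
apply: el_inj; rewrite !el_act.
by rewrite [RHS]ocAC0.
Qed.

(** General associativity: splitting any factor of an iterated product gives the product with one
    more factor. *)
Lemma oc_muPow (mu : P 1) i n : oc 0 (el mu) (el mu) = oc 1 (el mu) (el mu) ->
  (i <= n)%N -> oc i (el (muPow one mu n)) (el mu) = el (muPow one mu n.+1).
Proof.
move=> mu_assoc; elim: n i => [|n IHn] i le_in.
  by case: i le_in => // _; rewrite oc1l -[LHS](@oc1r 1).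
rewrite -[el (muPow one mu n.+1)]/(oc 1 (el mu) (el (muPow one mu n))).
rewrite -[el (muPow one mu n.+2)]/(oc 1 (el mu) (el (muPow one mu n.+1))).
case: i le_in => [_|i le_in]; last by rewrite -[i.+1]add1n -ocA // IHn.
(* In the first slot, parallel composition brings the two [mu] together, associativity moves the
   inner one to the right, and the tail is nested again. *)
rewrite -ocAC // mu_assoc -(@ocA 1 1) //=; congr oc.
Qed.

(** The forced image of the monomial [m]. The order of the operators is that of the enumeration,
    immaterial by [act_comm]. *)
Definition monoOp (D : P 0) (mu : P 1) n (m : 'X_{1..n.+1}) : P n :=
  foldr (fun (i : 'I_n.+1) => iter (m i) (@act D i n)) (muPow one mu n)
    (enum 'I_n.+1).

Lemma monoOp0 (D : P 0) (mu : P 1) n : monoOp D mu (0%MM : 'X_{1..n.+1}) = muPow one mu n.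
Proof. by rewrite /monoOp; elim: (enum _) => //= i s ->; rewrite mnm0E. Qed.

Lemma monoOpU (D : P 0) (mu : P 1) n (m : 'X_{1..n.+1}) (i : 'I_n.+1) :
  monoOp D mu (m + U_(i))%MM = act D i (monoOp D mu m).
Proof.
have in_enum : i \in enum 'I_n.+1 by rewrite mem_enum.
rewrite /monoOp; elim: (enum _) (enum_uniq 'I_n.+1) in_enum => //= k s IHs.
case/andP=> k_notin uniq_s; rewrite inE mnmDE mnm1E.
case: (eqVneq i k) => [-> _|ne_ik /= i_in].
  rewrite addn1 /=; congr (act _ _ (iter _ _ _)).
  (* The enumeration has no duplicates, so the exponents of the remaining slots are unchanged. *)
  elim: s k_notin {IHs uniq_s} => //= t s IHs; rewrite inE negb_or.
  by case/andP=> ne_kt /IHs->; rewrite mnmDE mnm1E (negPf ne_kt) addn0.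
rewrite addn0 IHs //; elim: (m k) => //= c ->.
by rewrite act_comm // -ltnS.
Qed.

End OperadLaws.
End Elements.

Lemma mpoly_mulX_ind (K : comNzRingType) n (A : {mpoly K[n]} -> Prop) :
  A 1 -> (forall a p q, A p -> A q -> A (a *: p + q)) ->
  (forall p i, A p -> A (p * 'X_i)) -> forall p, A p.
Proof.
move=> A1 AL AX; have A0 : A 0 by rewrite -(addNr 1) -scaleN1r; apply: AL.
elim/mpolyind => // a m p _ _; apply: AL; rewrite mpolyXE_id.
apply: big_rec => // i p' _ Ap'; rewrite mulrC.
by elim: (m i) => [|k IHk]; rewrite ?mulr1 // exprSr mulrA; apply: AX.
Qed.

Lemma act_QD (K : comNzRingType) (lam : K) n (i : 'I_n.+1) (p : Qcar K n) :
  act (Qcomp lam) (QD K) i p = (p : {mpoly K[n.+1]}) * 'X_i.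
Proof.
have le_in : (i <= n)%N by rewrite -ltnS.
apply: ev_inj => N y.
rewrite /act ev_pcast ev_Qcomp // evM /QD !evX addn0.
apply: (congr2 *%R); last by [].
apply: eq_ev => k _; rewrite /graft addn0 addn1 big_nat1.
by case: ltnP => // _; case: eqVneq => [->|].
Qed.

Lemma muPow_Q (K : comNzRingType) (lam : K) n :
  muPow (Qcomp lam) (Qone K) (Qmu K) n = (1 : {mpoly K[n.+1]}).
Proof.
elim: n => //= n ->; apply: ev_inj => N y.
by rewrite (@ev_Qcomp _ _ _ _ 1 n) // !ev1 mulr1.
Qed.

Lemma linear3 (K : comNzRingType) (U V : lmodType K) (h : U -> V) (a : K) (x y z : U) :
  (forall a x y, h (a *: x + y) = a *: h x + h y) ->
  h (x + y + a *: z) = h x + h y + a *: h z.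
Proof. by move=> hL; rewrite addrC hL -[x]scale1r hL !scale1r addrC. Qed.

(** * The linear map out of [Q] determined by [D] and [mu] *)

Section MorphismFromQ.
Variables (K : comNzRingType) (lam : K).
Variables (R : nat -> lmodType K) (one : R 0) (comp : opcomp_t R).
Variables (D : R 0) (mu : R 1).
Hypotheses (operadR : is_nsOperad one comp) (relR : AsDer_rel lam comp D mu).

(** In each arity, a map of modules over the polynomial ring, variables acting on [R n] by [act],
    with prescribed value at [1]. *)
Definition equivariant (f : forall n, Qcar K n -> R n) : Prop :=
  [/\ forall n (a : K) (x y : Qcar K n), f n (a *: x + y) = a *: f n x + f n y,
      forall n, f n (1 : {mpoly K[n.+1]}) = muPow comp one mu n
    & forall n (i : 'I_n.+1) (p : {mpoly K[n.+1]}),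
        f n (p * 'X_i) = act comp D i (f n p)].

Lemma equivariant_unique f g : equivariant f -> equivariant g ->
  forall n x, f n x = g n x.
Proof.
move=> [fL f1 fX] [gL g1 gX] n; apply: mpoly_mulX_ind => [|a p q fgp fgq|p i fgp].
- by rewrite f1 g1.
- by rewrite fL gL fgp fgq.
- by rewrite fX gX fgp.
Qed.

Definition fromQ n (p : Qcar K n) : R n :=
  \sum_(m <- msupp (p : {mpoly K[n.+1]})) p@_m *: monoOp comp one D mu m.

(** Summing over a common finite set of monomials lets polynomials with different supports be
    added. *)
Lemma fromQw n (p : Qcar K n) k : (msize (p : {mpoly K[n.+1]}) <= k)%N ->
  fromQ p = \sum_(m : 'X_{1..n.+1 < k}) p@_m *: monoOp comp one D mu m.
Proof.
move=> le_pk; pose I : subFinType _ := 'X_{1..n.+1 < k}.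
rewrite /fromQ (big_mksub I) ?msupp_uniq //=; last first.
  by move=> m /msize_mdeg_lt /leq_trans; apply.
by rewrite big_rmcond //= => m /memN_msupp_eq0 ->; rewrite scale0r.
Qed.

Lemma fromQ_linear n (a : K) (p q : Qcar K n) :
  fromQ (a *: p + q) = a *: fromQ p + fromQ q.
Proof.
pose k := maxn (msize (a *: p + q : {mpoly K[n.+1]}))
            (maxn (msize (p : {mpoly K[n.+1]})) (msize (q : {mpoly K[n.+1]}))).
rewrite !(@fromQw _ _ k) ?leq_max ?leqnn ?orbT // scaler_sumr -big_split /=.
by apply: eq_bigr => m _; rewrite mcoeffD mcoeffZ scalerDl scalerA.
Qed.

Lemma fromQX n (m : 'X_{1..n.+1}) :
  fromQ ('X_[m] : {mpoly K[n.+1]}) = monoOp comp one D mu m.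
Proof. by rewrite /fromQ msuppX big_seq1 mcoeffX eqxx scale1r. Qed.

Lemma fromQ_equivariant : equivariant fromQ.
Proof.
split=> [n a x y|n|n i p]; first exact: fromQ_linear.
  by rewrite -mpolyX0 fromQX monoOp0.
have le_in : (i <= n)%N by rewrite -ltnS.
have from0 : fromQ (0 : {mpoly K[n.+1]}) = 0 by rewrite /fromQ msupp0 big_nil.
elim/mpolyind: p => [|a m p _ _ IHp].
  rewrite mul0r from0 -[in RHS](addNr 0) -scaleN1r.
  by rewrite (act_linear operadR) // scaleN1r addNr.
rewrite mulrDl -scalerAl !fromQ_linear IHp -mpolyXD !fromQX.
by rewrite (monoOpU operadR) (act_linear operadR).
Qed.

(** * Equivariant maps respect all compositions *)

Section EquivariantIsMorphism.
Variable f : forall n, Qcar K n -> R n.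
Hypothesis fP : equivariant f.

Local Notation Qop := (Qcomp lam).
Local Notation Q_oc := (oc Qop).
Local Notation elQD := (el (QD K : Qcar K 0)).
Local Notation elQmu := (el (Qmu K : Qcar K 1)).

Let fel (u : opel (Qcar K)) : opel R := el (f (projT2 u)).

Lemma fel_act k u : (k <= projT1 u)%N -> fel (Q_oc k u elQD) = oc comp k (fel u) (el D).
Proof.
case: fP u => _ _ fX [n p] /= le_kn.
rewrite -[oc _ _ _ _]el_act -[oc _ _ _ _](el_act _ _ _ (f p)) /fel /=.
by have := act_QD lam (Ordinal (le_kn : k < n.+1)%N) p => /= ->; rewrite fX.
Qed.

Lemma fel_muPow n : fel (el (muPow Qop (Qone K) (Qmu K) n)) = el (muPow comp one mu n).
Proof. by case: fP => _ f1 _; rewrite muPow_Q /fel /= f1. Qed.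

(** Induction on the polynomial, one variable at a time. For [1] this is [oc_muPow]; a variable of
    another slot passes [mu] by the parallel axiom; the variable of slot [k] produces [D] composed
    with [mu], which the derivation relation rewrites. *)
Lemma fel_mu k u : (k <= projT1 u)%N -> fel (Q_oc k u elQmu) = oc comp k (fel u) (el mu).
Proof.
have opQ := Q_nsOperad lam; case: (Q_AsDer lam) => assocQ derQ.
case: relR fP => assocR derR [fL _ _].
case: u k => n p /=; elim/mpoly_mulX_ind: p => [|a p q IHp IHq|p i IHp] k le_kn.
- have elQ : existT _ n (1 : {mpoly K[n.+1]}) = el (muPow Qop (Qone K) (Qmu K) n).
    by rewrite muPow_Q.
  rewrite elQ (oc_muPow opQ (congr1 (@el _ (Qcar K) 2) assocQ) le_kn) !fel_muPow.
  by rewrite (oc_muPow operadR (congr1 (@el _ R 2) assocR) le_kn).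
- have {}IHp := el_inj (IHp _ le_kn); have {}IHq := el_inj (IHq _ le_kn).
  rewrite /fel /oc /=; congr el.
  rewrite [X in f X](comp_linearl opQ _ _ _ _ le_kn) !fL.
  by rewrite (comp_linearl operadR _ _ _ _ le_kn) -IHp -IHq.
- have le_in : (i <= n)%N by rewrite -ltnS.
  rewrite -[existT _ _ _]/(el _) -(act_QD lam) el_act.
  pose u := @el K (Qcar K) n p; rewrite -/u.
  have IHu j : (j <= projT1 u)%N -> fel (Q_oc j u elQmu) = oc comp j (fel u) (el mu).
    exact: IHp.
  have le_iu : (i <= projT1 u)%N by [].
  rewrite (fel_act le_iu); case: (ltngtP k i) => [lt_ki|lt_ik|->].
  + rewrite -(ocAC opQ _ _ lt_ki le_iu) fel_act ?(IHu _ le_kn); last by rewrite leq_add2r.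
    exact: (ocAC operadR).
  + rewrite (ocAC0 opQ (QD K : Qcar K 0) elQmu lt_ik (le_kn : (k <= projT1 u)%N)).
    rewrite fel_act ?(IHu _ le_kn); last by rewrite /=; lia.
    by rewrite (ocAC0 operadR).
  + have le_iFu : (i <= projT1 (fel u))%N by [].
    (* If [f] respects grafting [v] on [u], it respects grafting [v] followed by [D]. Starting from
       [mu], this reaches the three terms of the relation. *)
    have assocF j v v' : (j <= projT1 v)%N -> projT1 v = projT1 v' ->
        fel (Q_oc i u v) = oc comp i (fel u) v' ->
        fel (Q_oc i u (Q_oc j v elQD)) = oc comp i (fel u) (oc comp j v' (el D)).
      move=> le_jv eq_v IHv; have le_jv' : (j <= projT1 v')%N by rewrite -eq_v.
      rewrite (ocA opQ _ le_iu le_jv) (ocA operadR _ le_iFu le_jv').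
      by rewrite fel_act ?IHv; last exact: leq_add le_iu le_jv.
    have FmuD := assocF 0%N elQmu (el mu) isT erefl (IHu i le_iu).
    have Fmu1D := assocF 1%N elQmu (el mu) isT erefl (IHu i le_iu).
    have FmuDD :=
      assocF 1%N (Q_oc 0 elQmu elQD) (oc comp 0 (el mu) (el D)) isT erefl FmuD.
    (* Reassociate in [Q], then in [R], to expose [D] composed with [mu]. *)
    have := ocA opQ elQmu le_iu (leqnn 0 : (0 <= projT1 elQD)%N).
    rewrite addn0 => <-.
    have := ocA operadR (el mu) le_iFu (leqnn 0 : (0 <= projT1 (el D))%N).
    rewrite addn0 => <-.
    rewrite /fel /oc /= derQ derR; congr el.
    rewrite linear3 => [|a x y]; last by rewrite (comp_linearr opQ).
    rewrite linear3 => [|a x y]; last exact: fL.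
    rewrite linear3 => [|a x y]; last by rewrite (comp_linearr operadR).
    congr (_ + _ + _ *: _); [exact: el_inj FmuD|exact: el_inj Fmu1D|exact: el_inj FmuDD].
Qed.

Let right_good u :=
  forall i v, (i <= projT1 v)%N -> fel (Q_oc i v u) = oc comp i (fel v) (fel u).

(** By sequential associativity, composing with a composite is composing twice. *)
Lemma right_good_oc j u v : (j <= projT1 u)%N ->
  right_good u -> right_good v -> right_good (Q_oc j u v).
Proof.
move=> le_ju Gu Gv i w le_iw.
rewrite (ocA (Q_nsOperad lam)) // Gv ?Gu //=; last by rewrite leq_add.
by rewrite Gv // (ocA operadR).
Qed.

Lemma fel_one : fel (el (Qone K : Qcar K 0)) = el one.
Proof. exact: (fel_muPow 0). Qed.

Lemma fel_D : fel elQD = el D.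
Proof.
by rewrite -[elQD](oc1l (Q_nsOperad lam)) fel_act // fel_one (oc1l operadR).
Qed.

Lemma fel_Qmu : fel elQmu = el mu.
Proof.
by rewrite -[elQmu](oc1l (Q_nsOperad lam)) fel_mu // fel_one (oc1l operadR).
Qed.

Lemma right_good_all u : right_good u.
Proof.
have opQ := Q_nsOperad lam.
have Gone : right_good (el (Qone K : Qcar K 0)).
  by move=> i v le_iv; rewrite fel_one (oc1r opQ) // (oc1r operadR).
have GD : right_good elQD by move=> i v le_iv; rewrite fel_D fel_act.
have Gmu : right_good elQmu by move=> i v le_iv; rewrite fel_Qmu fel_mu.
case: u => n p; elim/mpoly_mulX_ind: p => [|a p q Gp Gq|p i Gp].
(* In every arity [1] is an iterated product of [Qmu]; below, multiplying by a variable is composing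
   with [QD]. Both are thus built from good elements. *)
- rewrite -(muPow_Q lam); elim: n => // n IHn.
  exact: (right_good_oc (leqnn 1 : (1 <= projT1 elQmu)%N) Gmu IHn).
- move=> i [m x] /= le_im; have Gpx := el_inj (Gp i (el x) le_im).
  have Gqx := el_inj (Gq i (el x) le_im).
  case: fP => fL _ _; congr el; rewrite /= (comp_linearr opQ) // !fL.
  by rewrite (comp_linearr operadR) // Gpx Gqx.
- rewrite -[existT _ _ _]/(el _) -(act_QD lam) el_act.
  by apply: right_good_oc => //=; rewrite -ltnS.
Qed.

Lemma equivariant_opMorphism : is_opMorphism (Qone K) Qop one comp f.
Proof.
case: fP => fL _ _; split; first exact: fL.
split; first exact: el_inj fel_one.
by move=> m n i x y le_im; exact: (el_inj (@right_good_all (el y) i (el x) le_im)).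
Qed.

End EquivariantIsMorphism.

(** Uniqueness: [muPow] and [act] are built from the generators by compositions, so any morphism
    with the right values on these preserves them. *)
Lemma opMorphism_equivariant (g : forall n, Qcar K n -> R n) :
  is_opMorphism (Qone K) (Qcomp lam) one comp g ->
  g 0%N (QD K) = D -> g 1%N (Qmu K) = mu -> equivariant g.
Proof.
move=> [gL [g1 gM]] gD gmu; split=> // [n|n i p].
  rewrite -(muPow_Q lam); elim: n => //= n IHn.
  by rewrite (gM 1%N n) // gmu IHn.
have le_in : (i <= n)%N by rewrite -ltnS.
have g_pcast m l (e : m = l) (q : Qcar K m) :
    el (g _ (pcast (F := fun k => Qcar K k : Type) e q)) = el (g _ q) by case: l / e.
rewrite -(act_QD lam); apply: el_inj; rewrite g_pcast el_act gM //.
by rewrite gD.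
Qed.

End MorphismFromQ.

Theorem theorem4p2 (K : comNzRingType) (lam : K) :
  (* Q^lambda is a ns operad *)
  is_nsOperad (Qone K) (Qcomp lam) /\
  (* it is isomorphic to lambda-AsDer via id |-> 1, D |-> x_1, mu |-> 1 in K[x_1,x_2] *)
  presents_AsDer lam (Qone K) (Qcomp lam) (QD K) (Qmu K) /\
  (* the operation D^{j_1}(a_1)...D^{j_n}(a_n) corresponds to x_1^{j_1}...x_n^{j_n} *)
  (forall (j : nat) (js : seq nat),
     DmonoOp (Qone K) (Qcomp lam) (QD K) (Qmu K) j js = Qmono K j js).
Proof.
split; [exact: Q_nsOperad|split; last exact: DmonoOp_Q].
split; [exact: Q_nsOperad|split; first exact: Q_AsDer].
move=> R one comp D mu operadR relR.
have eqf := fromQ_equivariant D mu operadR.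
exists (fromQ one comp D mu); split; first exact: equivariant_opMorphism eqf.

split; first exact: el_inj (fel_D lam operadR eqf).
split; first exact: el_inj (fel_Qmu operadR relR eqf).
move=> g gM gD gmu.
exact: equivariant_unique (opMorphism_equivariant gM gD gmu) eqf.
Qed.
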